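(* If an algorithm $G$ uniformly generates for a collection $\mathcal C$, then $G$ also uniformly generates for $\mathcal C$ with infinite omissions.
   Context: A language is an infinite subset of a countably infinite universe $U$; a collection is a set of languages. A generator algorithm is an arbitrary function $G$ from finite sequences of elements of $U$ to $U$, with output $z_t=G(x_0,\dots,x_t)$, and $S_t=\{x_0,\dots,x_t\}$. An enumeration of $K$ is an infinite sequence of pairwise distinct elements of $K$ containing every element of $K$. An enumeration of $K$ with infinite omissions is any infinite sequence of pairwise distinct elements of $K$ (not necessarily containing all of $K$). $G$ uniformly generates for $\mathcal C$ if there is $t^\star$ such that for every $K\in\mathcal C$, every enumeration $x$ of $K$, and every $t\ge t^\star$, $z_t\in K\setminus S_t$. $G$ uniformly generates with infinite omissions for $\mathcal C$ if the same holds with ''enumeration'' replaced by ''enumeration with infinite omissions''. *)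

(* Defs.v *)
From mathcomp Require Import all_boot all_classical.

Set Implicit Arguments.
Unset Strict Implicit.
Unset Printing Implicit Defensive.

Local Open Scope classical_set_scope.

Definition countably_infinite (U : Type) : Prop :=
  countable [set: U] /\ infinite_set [set: U].

Definition is_language (U : Type) (K : set U) : Prop := infinite_set K.

Definition is_collection (U : Type) (C : set (set U)) : Prop :=
  forall K, C K -> is_language K.

Definition generator (U : Type) : Type := seq U -> U.

(* z_t = G(x_0, ..., x_t); [mkseq x t.+1] is [:: x 0; ...; x t]. *)
Definition output (U : Type) (G : generator U) (x : nat -> U) (t : nat) : U :=
  G (mkseq x t.+1).

(* S_t = {x_0, ..., x_t} *)
Definition sample (U : Type) (x : nat -> U) (t : nat) : set U :=
  [set x i | i in [set i | i <= t]].

Definition enumeration_with_omissions (U : Type) (K : set U) (x : nat -> U) :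
    Prop :=
  injective x /\ forall i, K (x i).

Definition enumeration (U : Type) (K : set U) (x : nat -> U) : Prop :=
  [/\ injective x, forall i, K (x i) & forall u, K u -> exists i, x i = u].

Definition uniformly_generates (U : Type) (G : generator U)
    (C : set (set U)) : Prop :=
  exists tstar : nat, forall K, C K -> forall x, enumeration K x ->
    forall t, tstar <= t -> (K `\` sample x t) (output G x t).

Definition uniformly_generates_with_omissions (U : Type) (G : generator U)
    (C : set (set U)) : Prop :=
  exists tstar : nat, forall K, C K -> forall x,
    enumeration_with_omissions K x ->
    forall t, tstar <= t -> (K `\` sample x t) (output G x t).

(* Main.v *)
(** At time [t] the generator has only seen [x 0, ..., x t]. This prefix of an
    omitting sequence extends to a full enumeration of [K], because [K] minus
    the prefix is countably infinite; hence the same threshold works. *)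
Require Import Defs.
From mathcomp Require Import all_boot all_classical.

Local Open Scope classical_set_scope.

Lemma exists_enumeration (U : Type) (A : set U) :
  countable A -> infinite_set A -> exists y, enumeration A y.
Proof.
move=> cA iA.
have /card_bijP[f [g fK gK]] := eq_card_nat cA iA.
(* The bijection lives between the subtypes of [A] and [[set: nat]]; [h] wraps a number so that [g]
   can be applied to it. *)
pose h n : [set: nat] := SigSub (mem_set (I : [set: nat] n)).
have hK n : sval (h n) = n by [].
exists (fun n => sval (g (h n))); split.
- by move=> m n /val_inj/(can_inj gK) hmn; rewrite -(hK m) hmn.
- by move=> n; apply: set_mem; apply: valP.
- move=> u Au; pose a : A := SigSub (mem_set Au).
  exists (sval (f a)).
  have -> : h (sval (f a)) = f a by apply: val_inj.
  by rewrite fK.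
Qed.

Lemma finite_sample (U : Type) (x : nat -> U) t : finite_set (sample x t).
Proof. exact/finite_image/(finite_II t.+1). Qed.

Lemma extend_to_enumeration (U : Type) (K : set U) (x : nat -> U) (t : nat) :
  countable K -> infinite_set K -> enumeration_with_omissions K x ->
  exists2 y, enumeration K y & forall i, i <= t -> y i = x i.
Proof.
move=> cK iK [xI xK].
have cD : countable (K `\` sample x t).
  by apply: sub_countable cK; apply: subset_card_le => u [].
have iD := infinite_setD iK (finite_sample _ x t).
have [z [zI zD zS]] := exists_enumeration _ _ cD iD.
have xz i j : i <= t -> x i <> z j.
  by move=> it xzij; case: (zD j) => _; apply; exists i.
(* The prefix of [x] up to index [t], then [z] shifted by the [t.+1] places already taken. The two
   blocks are disjoint because [z] avoids the sample. *)
exists (fun i => if i <= t then x i else z (i - t.+1)); last by move=> i ->.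
split.
- move=> i j; case: leqP => it; case: leqP => jt.
  + exact: xI.
  + by move/(xz _ _ it).
  + by move/esym/(xz _ _ jt).
  (* Truncated subtraction is harmless here: both indices exceed [t], so adding [t.+1] back recovers
     them. *)
  + by move/zI => ij; rewrite -(subnK it) ij subnK.
- by move=> i; case: leqP => // _; case: (zD (i - t.+1)).
- move=> u Ku; have [[i it <-]|nSu] := pselect (sample x t u).
    by exists i; rewrite it.
  have [j <-] := zS u (conj Ku nSu).
  by exists (j + t.+1); rewrite leqNgt addnS ltnS leq_addl /= -addnS addnK.
Qed.

Theorem theorem4p5 (U : Type) (U_countably_infinite : countably_infinite U)
    (C : set (set U)) (C_collection : is_collection C) (G : generator U) :
  uniformly_generates G C -> uniformly_generates_with_omissions G C.
Proof.
case=> tstar genG; exists tstar => K CK x xK t le_t.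
have cK : countable K.
  by case: U_countably_infinite => cU _; apply: sub_countable cU; apply: subset_card_le.
have [y yK yx] := extend_to_enumeration _ _ _ t cK (C_collection _ CK) xK.
have := genG K CK y yK t le_t.
(* Both the output and the sample at time [t] read only indices up to [t], where [y] and [x] agree,
   so the conclusion for [y] carries over to [x]. *)
have -> : output G y t = output G x t.
  rewrite /output; congr G; apply/eq_in_map => i.
  by rewrite mem_iota => /andP[_ it]; apply: yx.
have -> : sample y t = sample x t; last by [].
by apply: eq_imagel => i; apply: yx.
Qed.
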